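(* Let $(\Omega,T)$ be a minimal subshift over a finite alphabet $A$. Then the following are equivalent: (i) The subshift $(\Omega,T)$ satisfies (SET), i.e. it admits a uniform subadditive ergodic theorem. (ii) The subshift $(\Omega,T)$ satisfies (PQ), i.e. uniform positivity of quasiweights.
   Context: Let $A$ be a finite set (the alphabet) with the discrete topology, give $A^{\mathbb{Z}}$ the product topology, and let $T:A^{\mathbb{Z}}\to A^{\mathbb{Z}}$, $(Ta)(n)=a(n+1)$, be the shift. A subshift $(\Omega,T)$ over $A$ is a nonempty closed subset $\Omega\subseteq A^{\mathbb{Z}}$ invariant under $T$ ($T(\Omega)=\Omega$). It is minimal if every orbit $\{T^n\omega : n\in\mathbb{Z}\}$, $\omega\in\Omega$, is dense in $\Omega$. Let $\mathcal{W}$ be the set of all finite subwords (blocks of consecutive letters) of elements of $\Omega$, and let $|w|$ be the length of a word $w$. Limits and liminfs as $|w|\to\infty$ are taken over $w\in\mathcal{W}$. A function $F:\mathcal{W}\to\mathbb{R}$ is subadditive if $F(ab)\le F(a)+F(b)$ for all words $a,b$ with $ab\in\mathcal{W}$. For $n\in\mathbb{N}$, $n\geq 1$, put $F^{(n)}=\max\{F(v)/|v| : v\in\mathcal{W},\ |v|=n\}$. (SET): for every subadditive function $F:\mathcal{W}\to\mathbb{R}$, the limit $\lim_{|w|\to\infty}\frac{F(w)}{|w|}$ exists and equals $\inf_{n\in\mathbb{N}}F^{(n)}$ (the value $-\infty$ being allowed for both). For nonempty $v\in\mathcal{W}$ and $w\in\mathcal{W}$ let $l_v(w)=(\text{maximal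 number of pairwise disjoint, i.e. non-overlapping, copies of } v \text{ in } w)\cdot|v|$, and let $\nu(v)=\liminf_{|w|\to\infty}\frac{l_v(w)}{|w|}$. (PQ): there exists a constant $C>0$ with $\nu(v)\ge C$ for all nonempty $v\in\mathcal{W}$. *)

(* Defs.v *)
From HB Require Import structures.
From mathcomp Require Import all_boot all_order all_algebra.
From mathcomp Require Import all_classical all_reals all_analysis.
Set Implicit Arguments.
Unset Strict Implicit.
Unset Printing Implicit Defensive.
Import Order.TTheory GRing.Theory Num.Theory.
Import numFieldNormedType.Exports.
Local Open Scope classical_set_scope.
Local Open Scope ring_scope.

Definition full_shift (A : finType) : topologicalType :=
  {ptws int -> discrete_topology A}.

Section Subshift.
Variable A : finType.
Implicit Types (a : full_shift A) (Omega : set (full_shift A)).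

(* The integer power [T^m] of the shift map [T]; see [shift_powD]. *)
Definition shift_pow (m : int) (a : full_shift A) : full_shift A :=
  fun n : int => a (n + m).

Definition shift_map (a : full_shift A) : full_shift A :=
  fun n : int => a (n + 1).

Lemma shift_pow0 a : shift_pow 0 a = a.
Proof. by apply/funext => n; rewrite /shift_pow addr0. Qed.

Lemma shift_pow1 a : shift_pow 1 a = shift_map a.
Proof. by []. Qed.

Lemma shift_powD (m n : int) a :
  shift_pow (m + n) a = shift_pow m (shift_pow n a).
Proof. by apply/funext => k; rewrite /shift_pow addrA. Qed.

Definition shift_orbit (a : full_shift A) : set (full_shift A) :=
  range (fun m : int => shift_pow m a).

Definition subshift (Omega : set (full_shift A)) : Prop :=
  [/\ Omega !=set0, closed Omega & shift_map @` Omega = Omega].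

Definition minimal_subshift (Omega : set (full_shift A)) : Prop :=
  subshift Omega /\
  forall a, Omega a -> Omega `<=` closure (shift_orbit a).

Definition block (a : full_shift A) (n : int) (k : nat) : seq A :=
  mkseq (fun i => a (n + i%:Z)) k.

(* The empty word is included, as the block of length 0. *)
Definition language (Omega : set (full_shift A)) : set (seq A) :=
  [set w | exists2 a, Omega a & exists n : int, w = block a n (size w)].

(* The filter "[|w|] tends to infinity, [w] in the language"; it is proper
   as soon as [Omega] is nonempty, see [long_words_proper]. *)
Definition long_words (Omega : set (full_shift A)) : set_system (seq A) :=
  filter_from [set: nat]
    (fun N => [set w | language Omega w /\ (N <= size w)%N]).

Global Instance long_words_filter Omega : Filter (long_words Omega).
Proof.
apply: filter_from_filter; first by exists 0%N.
move=> M N _ _; exists (maxn M N) => // w [Lw].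
by rewrite geq_max => /andP[Mw Nw]; split.
Qed.

Lemma long_words_proper Omega :
  Omega !=set0 -> ProperFilter (long_words Omega).
Proof.
move=> [a Oa]; apply: filter_from_proper => N _.
exists (block a 0 N); rewrite /= size_mkseq; split => //.
by exists a => //; exists 0; rewrite size_mkseq.
Qed.

Variable R : realType.

(* A real function on the language is represented by a function on all words
   whose values outside the language are never used. *)
Definition subadditive (Omega : set (full_shift A)) (F : seq A -> R) : Prop :=
  forall u v, language Omega (u ++ v) -> F (u ++ v) <= F u + F v.

(* A finite maximum over the words of length [n] in the language; the unit
   [-oo] is irrelevant when [Omega] is nonempty. *)
Definition max_mean (Omega : set (full_shift A)) (F : seq A -> R) (n : nat) :
    \bar R :=
  \big[Order.max/-oo%E]_(v : n.-tuple A | tval v \in language Omega)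
    (F v / (size v)%:R)%:E.

Definition SET (Omega : set (full_shift A)) : Prop :=
  forall F : seq A -> R, subadditive Omega F ->
    (F w / (size w)%:R)%:E @[w --> long_words Omega] -->
      ereal_inf [set max_mean Omega F n | n in [set n | (1 <= n)%N]].

(* [I] is a set of starting positions of occurrences of [v] in [w], no two of
   which overlap. *)
Definition disjoint_copies (v w : seq A) (I : {set 'I_(size w)}) : bool :=
  [forall i in I, prefix v (drop i w)] &&
  [forall i in I, forall j in I,
     (i != j) ==> ((i + size v <= j) || (j + size v <= i))%N].

Definition covered_length (v w : seq A) : nat :=
  ((\max_(I : {set 'I_(size w)} | disjoint_copies v I) #|I|) * size v)%N.

(* [limf_einf] asks its source for a (here irrelevant) topology: words are
   given the discrete one. *)
Definition quasiweight (Omega : set (full_shift A)) (v : seq A) : \bar R :=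
  limf_einf (fun w : discrete_topology (seq A) =>
    ((covered_length v w)%:R / (size w)%:R)%:E : \bar R) (long_words Omega).

Definition PQ (Omega : set (full_shift A)) : Prop :=
  exists2 C : R, 0 < C &
    forall v, language Omega v -> v != [::] ->
      (C%:E <= quasiweight Omega v)%E.

End Subshift.

(* Main.v *)
Require Import Defs.
From mathcomp Require Import all_boot all_order all_algebra.
From mathcomp Require Import all_classical all_reals all_analysis.
From mathcomp Require Import zify lra.

Set Implicit Arguments.
Unset Strict Implicit.
Unset Printing Implicit Defensive.

Import Order.TTheory GRing.Theory Num.Theory.
Import numFieldNormedType.Exports.
Local Open Scope classical_set_scope.
Local Open Scope ring_scope.

(** Why the theorem is true.  Write [l_v(w)] for [covered_length v w].

    (PQ) implies (SET).  Let [F] be subadditive and [m] the infimum of the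
    maximal means.  Cutting a word into pieces of length [n] gives
    [F w <= b |w| + K] as soon as [b] exceeds the [n]-th maximal mean
    ([subadditive_affine_bound]); hence the means are eventually below any
    number above [m], which settles the case [m = -oo].  Let [m = r] be real
    and suppose that arbitrarily long words [v] have [F v <= (r - d) |v|].
    By (PQ) each of them fills a fixed proportion [C / 2] of every long word
    [w] with disjoint copies.  Cut [w] along these copies: a copy saves
    [d |v|] over the affine bound and costs at most one more additive
    constant [K] ([subadditive_disjoint_copies]), and [K] is negligible
    against [d |v|] when [v] is long.  So the means of all long words are at
    most [r - e] for a fixed [e > 0], and then so is some maximal mean, which
    contradicts the choice of [r] ([near_mean_lower]).

    (SET) implies (PQ).  The function [- l_v] is subadditive, so (SET) turns
    a small lower limit of [l_v(w) / |w|] into a small limit: every long word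
    is sparsely covered by [v] ([SET_covered_length]).  If (PQ) fails, such
    words [v] exist with any prescribed sparsity and of any length, because
    prolonging [v] costs only a factor bounded by the prolongation
    ([covered_length_extend]).  Choose a sequence [v_k] and lengths [N_k] with
    [l_(v_k)(w) <= 2^-(k+2) |w|] for [|w| >= N_k], each word longer than the
    previous threshold, and let [F = - sum_k l_(v_k)].  Then the mean of [F]
    is at most [-1] at each [v_k], but at least [- 1/2] at the words of length
    [N_n], since the words [v_k] with [k > n] do not fit into them.  So the
    means of [F] do not converge ([SET_PQ]). *)

(** * The language of a subshift *)

Lemma block_cat (A : finType) (a : full_shift A) (n : int) (k m : nat) :
  block a n (k + m) = block a n k ++ block a (n + k%:Z) m.
Proof.
rewrite /block /mkseq iotaD map_cat add0n; congr cat.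
rewrite -[in iota k m](addn0 k) iotaDl -map_comp.
by apply: eq_map => i /=; rewrite PoszD addrA.
Qed.

Lemma language_cat (A : finType) (Omega : set (full_shift A)) (u v : seq A) :
  language Omega (u ++ v) -> language Omega u /\ language Omega v.
Proof.
move=> [a Oa [n]]; rewrite size_cat block_cat => /eqP.
rewrite eqseq_cat ?size_mkseq// => /andP[/eqP uE /eqP vE].
by split; exists a => //; [exists n|exists (n + (size u)%:Z)].
Qed.

Lemma language_extend (A : finType) (Omega : set (full_shift A)) (v : seq A)
    (N : nat) :
  language Omega v -> exists2 v', language Omega (v ++ v') & size v' = N.
Proof.
move=> [a Oa [n vE]]; exists (block a (n + (size v)%:Z) N).
  exists a => //; exists n.
  by rewrite size_cat size_mkseq block_cat -vE.
by rewrite size_mkseq.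
Qed.

Lemma language_word (A : finType) (Omega : set (full_shift A)) (N : nat) :
  Omega !=set0 -> exists2 w, language Omega w & size w = N.
Proof.
move=> [a Oa]; exists (block a 0 N); last by rewrite size_mkseq.
by exists a => //; exists 0; rewrite size_mkseq.
Qed.

(** * Disjoint copies *)

Lemma disjoint_copiesP {A : finType} {v w : seq A} {I : {set 'I_(size w)}} :
  reflect ((forall i, i \in I -> prefix v (drop i w)) /\
           (forall i j, i \in I -> j \in I -> i != j ->
              (i + size v <= j)%N || (j + size v <= i)%N))
    (disjoint_copies v I).
Proof.
apply: (iffP andP) => [[/forall_inP pI /forall_inP dI]|[pI dI]]; split => //.
- by move=> i j iI jI ij; have /forall_inP/(_ j jI)/implyP := dI i iI; apply.
- exact/forall_inP.
- apply/forall_inP => i iI; apply/forall_inP => j jI; apply/implyP.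
  exact: dI.
Qed.

Lemma size_prefix_drop (A : eqType) (v w : seq A) (i : nat) :
  (i <= size w)%N -> prefix v (drop i w) -> (i + size v <= size w)%N.
Proof. by move=> iw /prefixP[s /(congr1 size)]; rewrite size_drop size_cat; lia. Qed.

Lemma covered_length_ge {A : finType} {v w : seq A} {I : {set 'I_(size w)}} :
  disjoint_copies v I -> (#|I| * size v <= covered_length v w)%N.
Proof.
move=> dI; rewrite leq_mul2r; apply/orP; right.
exact: (bigop.leq_bigmax_cond (P := fun I => disjoint_copies v I)).
Qed.

Lemma covered_length_attained {A : finType} (v w : seq A) :
  exists2 I : {set 'I_(size w)},
    disjoint_copies v I & covered_length v w = (#|I| * size v)%N.
Proof.
have d0 : disjoint_copies v (finset.set0 : {set 'I_(size w)}).
  by apply/disjoint_copiesP; split => [i|i j]; rewrite finset.in_set0.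
have : (0 < #|[pred I : {set 'I_(size w)} | disjoint_copies v I]|)%N.
  by apply/card_gt0P; exists finset.set0.
move=> /(bigop.eq_bigmax_cond (fun I : {set 'I_(size w)} => #|I|)).
by move=> [I dI IE]; exists I => //; rewrite /covered_length IE.
Qed.

Lemma covered_length_self (A : finType) (v : seq A) :
  (size v <= covered_length v v)%N.
Proof.
case: (posnP (size v)) => [-> //|v0].
have d1 : disjoint_copies v (finset.set1 (Ordinal v0)).
  apply/disjoint_copiesP; split => [i|i j].
    by rewrite finset.in_set1 => /eqP -> /=; rewrite drop0 prefix_refl.
  by rewrite !finset.in_set1 => /eqP -> /eqP ->; rewrite eqxx.
by have := covered_length_ge d1; rewrite cards1 mul1n.
Qed.

Lemma covered_length_small (A : finType) (v w : seq A) :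
  (size w < size v)%N -> covered_length v w = 0%N.
Proof.
move=> wv; have [I /disjoint_copiesP[pI _] ->] := covered_length_attained v w.
case: (set_0Vmem I) => [->|[i iI]]; first by rewrite cards0.
have := size_prefix_drop (ltnW (ltn_ord i)) (pI i iI).
by move=> /(leq_trans (leq_addl _ _)); rewrite leqNgt wv.
Qed.

(** Each copy of [v ++ v'] starts with a copy of [v], so at least as many
    disjoint copies of [v] are available. *)
Lemma covered_length_extend (A : finType) (v v' w : seq A) :
  (covered_length (v ++ v') w * size v <=
   covered_length v w * size (v ++ v'))%N.
Proof.
have [I /disjoint_copiesP[pI dI] ->] := covered_length_attained (v ++ v') w.
rewrite mulnAC leq_mul2r; apply/orP; right; apply: covered_length_ge.
apply/disjoint_copiesP; split => [i /pI|i j iI jI ij].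
  exact: catl_prefix.
by move: (dI i j iI jI ij); rewrite size_cat; lia.
Qed.

(** Disjoint copies in the two factors remain disjoint in the product, which
    may gain copies across the junction. *)
Lemma covered_length_superadditive (A : finType) (v u w : seq A) :
  (covered_length v u + covered_length v w <= covered_length v (u ++ w))%N.
Proof.
have [I /disjoint_copiesP[pI dI] ->] := covered_length_attained v u.
have [J /disjoint_copiesP[pJ dJ] ->] := covered_length_attained v w.
pose f (i : 'I_(size u)) := cast_ord (esym (size_cat u w)) (lshift (size w) i).
pose g (j : 'I_(size w)) := cast_ord (esym (size_cat u w)) (rshift (size u) j).
have fI : injective f by move=> i j /cast_ord_inj/lshift_inj.
have gI : injective g by move=> i j /cast_ord_inj/rshift_inj.
have fg i j : (f i < g j)%N by rewrite /= (leq_trans (ltn_ord i))// leq_addr.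
have uI i : i \in I -> (i + size v <= size u)%N.
  by move=> /pI; apply: size_prefix_drop; exact: ltnW.
(* The two families lie on different sides of the junction, hence their
   cardinals add up. *)
have disj : (f @: I :&: g @: J)%SET = finset.set0.
  apply/finset.setP => k; rewrite !inE.
  apply/negbTE/negP => /andP[/imsetP[i _ ->] /imsetP[j _ /(congr1 val)/eqP]].
  by rewrite ltn_eqF// fg.
rewrite -mulnDl -(card_imset I fI) -(card_imset J gI) -cardsUI.
rewrite disj cards0 addn0; apply: covered_length_ge; apply/disjoint_copiesP; split.
  move=> k /finset.setUP[/imsetP[i iI ->]|/imsetP[j jJ ->]] /=; last first.
    by rewrite drop_cat ltnNge leq_addr/= addKn pJ.
  by rewrite drop_cat ltn_ord; apply: prefix_catl; exact: pI.
move=> k l /finset.setUP[/imsetP[i iI ->]|/imsetP[i iI ->]]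
  /finset.setUP[/imsetP[j jJ ->]|/imsetP[j jJ ->]] ij /=.
- by apply: dI => //; apply: contraNneq ij => ->.
- by have := uI i iI; lia.
- by have := uI j jJ; lia.
- by rewrite -!addnA !leq_add2l; apply: dJ => //; apply: contraNneq ij => ->.
Qed.

(** * Affine bounds on subadditive functions *)

Lemma short_words_bound (R : realType) (A : finType) (G : seq A -> R)
    (n : nat) :
  exists2 K, 0 <= K & forall w, (size w < n)%N -> G w <= K.
Proof.
exists (\sum_(m < n) \sum_(t : m.-tuple A) `|G t|).
  by apply: sumr_ge0 => m _; apply: sumr_ge0.
move=> w wn; rewrite (bigD1 (Ordinal wn))//= (bigD1 (in_tuple w))//= -addrA.
apply: (le_trans (ler_norm _)); rewrite lerDl addr_ge0//.
  by apply: sumr_ge0.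
by apply: sumr_ge0 => m _; apply: sumr_ge0.
Qed.

(** Cut [w] into blocks of length [n]; only the last, incomplete, block may
    exceed the linear bound, and [K] bounds the excess over all words shorter
    than [n]. *)
Lemma subadditive_affine_bound (R : realType) (A : finType)
    (Omega : set (full_shift A)) (F : seq A -> R) (n : nat) (b : R) :
  Defs.subadditive Omega F -> (0 < n)%N ->
  (forall v, language Omega v -> size v = n -> F v <= b * n%:R) ->
  exists2 K, 0 <= K & forall w, language Omega w -> F w <= b * (size w)%:R + K.
Proof.
move=> Fsub n0 Fb.
have [K K0 HK] := short_words_bound (fun w => F w - b * (size w)%:R) n.
exists K => // w; have [k] := ubnP (size w).
elim: k w => // k IH w wk Lw.
case: (ltnP (size w) n) => [/HK|nw]; first by rewrite lerBlDl.
have ws : w = take n w ++ drop n w by rewrite cat_take_drop.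
have [Lt Ld] : language Omega (take n w) /\ language Omega (drop n w).
  by apply: language_cat; rewrite -ws.
have Ft : F (take n w) <= b * n%:R by apply: Fb => //; rewrite size_takel.
have sd : (size (drop n w) < k)%N by rewrite size_drop; lia.
have := IH _ sd Ld; rewrite size_drop natrB// => Fd.
have : F w <= F (take n w) + F (drop n w) by rewrite {1}ws; apply: Fsub; rewrite -ws.
by lra.
Qed.

(** The copies in [I] split [w] into [#|I|] copies of [v] and [#|I| + 1] gaps,
    possibly empty or short; each gap obeys the affine bound, and the copies
    contribute [F v] instead of [a |v|]. *)
Lemma subadditive_disjoint_copies (R : realType) (A : finType)
    (Omega : set (full_shift A)) (F : seq A -> R) (a K : R) (v w : seq A)
    (I : {set 'I_(size w)}) :
  Defs.subadditive Omega F ->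
  (forall u, language Omega u -> F u <= a * (size u)%:R + K) ->
  language Omega w -> (0 < size v)%N -> disjoint_copies v I ->
  F w <= a * (size w)%:R + K + #|I|%:R * (K + F v - a * (size v)%:R).
Proof.
move=> Fsub Fa Lw v0 /disjoint_copiesP[pI dI].
pose J n : {set 'I_(size w)} := [set i in I | (i + size v <= n)%N]%SET.
have LF x y : language Omega (x ++ y) ->
    [/\ language Omega x, language Omega y & F (x ++ y) <= F x + F y].
  by move=> Lxy; have [? ?] := language_cat Lxy; split=> //; apply: Fsub.
(* Induction on the number of copies that fit into the prefix of length [n]:
   the last one is split off, and the prefix ends where it starts. *)
suff main m n : (n <= size w)%N -> #|J n| = m ->
    F (take n w) <= a * n%:R + K + m%:R * (K + F v - a * (size v)%:R).
  have -> : I = J (size w).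
    apply/finset.setP => i; rewrite inE; case: (boolP (i \in I)) => //= /pI.
    by move=> /size_prefix_drop -> //; exact: ltnW.
  by rewrite -[X in F X]take_size; exact: main.
elim: m n => [|m IH] n nw Jn.
  rewrite mul0r addr0 -[in X in X%:R](size_takel nw); apply: Fa.
  by move: Lw; rewrite -{1}(cat_take_drop n w) => /language_cat[].
have /card_gt0P[i0 i0J] : (0 < #|J n|)%N by rewrite Jn.
pose i := [arg max_(k > i0 | k \in J n) (k : nat)]%N.
have [iJ imax] : i \in J n /\ forall k, k \in J n -> (k <= i)%N.
  by rewrite /i; case: arg_maxnP => // k kJ kmax; split.
have /andP[iI ivn] : (i \in I) && (i + size v <= n)%N by move: iJ; rewrite inE.
have Ji : #|J i| = m.
  apply/eqP; rewrite -eqSS -Jn (cardsD1 i (J n)) iJ add1n eqSS.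
  apply/eqP/eq_card => k; rewrite !inE.
  case: (boolP (k \in I)) => kI /=; last by rewrite andbF.
  have [->|ki] := eqVneq k i; first by apply/negbTE; lia.
  have := dI k i kI iI ki; have := imax k; rewrite inE kI /=; lia.
have /prefixP[s sE] := pI i iI.
have tE : take n w = take i w ++ (v ++ take (n - (i + size v)) s).
  rewrite -{1}(cat_take_drop i w) sE take_cat size_takel ?(ltnW (ltn_ord i))//.
  rewrite ltnNge (leq_trans (leq_addr _ _) ivn)/= take_cat; congr (_ ++ _).
  case: ltnP => [|_]; first lia.
  by congr (_ ++ take _ _); lia.
set r := take _ s in tE.
have sr : n = (i + (size v + size r))%N.
  rewrite -(size_takel nw) tE !size_cat size_takel//.
  exact: ltnW (ltn_ord i).
have Ln : language Omega (take n w).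
  by move: Lw; rewrite -{1}(cat_take_drop n w) => /language_cat[].
move: Ln; rewrite tE => /LF[_ /LF[_ /Fa Fr F2] F1].
have := IH _ (ltnW (ltn_ord i)) Ji.
by rewrite sr !natrD -[m.+1%:R]natr1; lra.
Qed.

(** * From quasiweights to the subadditive ergodic theorem *)

Lemma max_mean_lt (R : realType) (A : finType) (Omega : set (full_shift A))
    (F : seq A -> R) (n : nat) (b : R) (v : seq A) :
  (max_mean Omega F n < b%:E)%E -> language Omega v -> size v = n ->
  F v / n%:R < b.
Proof.
move=> /bigmax_ltP[_ Hb] Lv vn; have vnP : size v == n by apply/eqP.
have := Hb (Tuple vnP) (mem_set Lv).
by rewrite lte_fin /= vn.
Qed.

Lemma max_mean_le (R : realType) (A : finType) (Omega : set (full_shift A))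
    (F : seq A -> R) (n : nat) (b : R) :
  (forall v, language Omega v -> size v = n -> F v / n%:R <= b) ->
  (max_mean Omega F n <= b%:E)%E.
Proof.
move=> Hb; apply: bigmax_le; first exact: leNye.
move=> v /set_mem Lv; rewrite lee_fin size_tuple.
by apply: Hb => //; rewrite size_tuple.
Qed.

(** An additive constant is negligible in the mean of a long word. *)
Lemma near_mean_le (R : realType) (A : finType) (Omega : set (full_shift A))
    (F : seq A -> R) (b b' K : R) (M : nat) :
  b < b' ->
  (forall w, language Omega w -> (M <= size w)%N ->
    F w <= b * (size w)%:R + K) ->
  \forall w \near long_words Omega, F w / (size w)%:R <= b'.
Proof.
move=> bb' HF; have bb0 : 0 < b' - b by rewrite subr_gt0.
exists (maxn M.+1 (Num.truncn (K / (b' - b))).+1) => // w [Lw].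
rewrite geq_max => /andP[Mw Kw] /=.
have w0 : 0 < (size w)%:R :> R by rewrite ltr0n; lia.
rewrite ler_pdivrMr//; apply: (le_trans (HF w Lw (ltnW Mw))).
have : K / (b' - b) < (size w)%:R.
  by apply: (lt_le_trans (truncnS_gt _)); rewrite ler_nat.
by rewrite ltr_pdivrMr// => ?; lra.
Qed.

Lemma quasiweight_lower (R : realType) (A : finType)
    (Omega : set (full_shift A)) (v : seq A) (C : R) :
  (C%:E < quasiweight R Omega v)%E ->
  exists N, forall w, language Omega w -> (N <= size w)%N ->
    C * (size w)%:R <= (covered_length v w)%:R.
Proof.
rewrite /quasiweight limf_einfE => /ereal_sup_gt[_ [V [N _ NV] <-]] CV.
exists N.+1 => w Lw Nw; have : V w by apply: NV; split => //; exact: ltnW.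
move=> Vw; have : (C%:E < ((covered_length v w)%:R / (size w)%:R)%:E :> \bar R)%E.
  by apply: (lt_le_trans CV); apply: ereal_inf_lbound; exists w.
by rewrite lte_fin ltr_pdivlMr ?ltr0n; [exact: ltW|lia].
Qed.

(** A word [v] of mean at most [r - d] propagates: filling at least the
    proportion [C / 2] of every long word, it saves [d C / 2] on the mean.
    Half of this pays for the additive constants at the cuts, half of the rest
    for using the affine bound with slope [r + eps], [eps = d C / 8], instead
    of [r].  The uniform deficit that is left is impossible because [r] is the
    infimum of the maximal means. *)
Lemma near_mean_lower (R : realType) (A : finType)
    (Omega : set (full_shift A)) (F : seq A -> R) (r d : R) :
  Omega !=set0 -> PQ R Omega -> Defs.subadditive Omega F ->
  ereal_inf [set max_mean Omega F n | n in [set n | (1 <= n)%N]] = r%:E ->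
  (forall e, 0 < e -> exists2 K, 0 <= K &
     forall w, language Omega w -> F w <= (r + e) * (size w)%:R + K) ->
  0 < d ->
  \forall w \near long_words Omega, r - d <= F w / (size w)%:R.
Proof.
move=> Omega0 [C C0 HC] Fsub infE up d0; apply: contrapT => nnear.
have low N : exists v, [/\ language Omega v, (N < size v)%N &
    F v <= (r - d) * (size v)%:R].
  apply: contrapT => nv; apply: nnear; exists N.+1 => // w [Lw Nw] /=.
  rewrite leNgt; apply/negP => Fw; apply: nv; exists w; split => //.
  by rewrite -ler_pdivrMr ?ltr0n; [exact: ltW|lia].
pose eps := d * C / 8.
have eps0 : 0 < eps by rewrite /eps divr_gt0// mulr_gt0.
have [K K0 HK] := up eps eps0.
(* The length of [v] is chosen so that the constant paid per copy is at most
   half of what the copy saves. *)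
have [v [Lv vN Fv]] := low (Num.truncn (K / (d / 2))).
have v0 : (0 < size v)%N by lia.
have Kv : K <= d / 2 * (size v)%:R.
  rewrite mulrC -ler_pdivrMr ?divr_gt0//.
  by apply/ltW/(lt_le_trans (truncnS_gt _)); rewrite ler_nat.
have C2v : ((C / 2)%:E < quasiweight R Omega v)%E.
  apply: lt_le_trans (HC v Lv _); first by rewrite lte_fin; lra.
  by rewrite -size_eq0 -lt0n.
have [M HM] := quasiweight_lower C2v.
have Fup w : language Omega w -> (M <= size w)%N ->
    F w <= (r - eps) * (size w)%:R + K.
  move=> Lw Mw; have [I dI cI] := covered_length_attained v w.
  have := HM w Lw Mw; rewrite cI natrM => cov.
  have := subadditive_disjoint_copies Fsub HK Lw v0 dI.
  have gain : #|I|%:R * (K + F v - (r + eps) * (size v)%:R) <=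
      - (d / 2) * (#|I|%:R * (size v)%:R).
    rewrite mulrCA ler_wpM2l//.
    have : 0 <= eps * (size v)%:R by rewrite mulr_ge0// ltW.
    by lra.
  have : d / 2 * (C / 2 * (size w)%:R) <= d / 2 * (#|I|%:R * (size v)%:R).
    by rewrite ler_wpM2l// ltW// divr_gt0.
  have -> : d / 2 * (C / 2 * (size w)%:R) = 2 * eps * (size w)%:R.
    by rewrite /eps; lra.
  by lra.
have [N _ HN] : \forall w \near long_words Omega,
    F w / (size w)%:R <= r - eps / 2 by apply: near_mean_le Fup; lra.
have : (ereal_inf [set max_mean Omega F n | n in [set n | (1 <= n)%N]] <=
        (r - eps / 2)%:E)%E.
  apply: le_trans (_ : (max_mean Omega F N.+1 <= _)%E).
    by apply: ereal_inf_lbound; exists N.+1.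
  by apply: max_mean_le => w Lw wN; rewrite -wN; apply: HN; split => //; lia.
by rewrite infE lee_fin; lra.
Qed.

(** The upper bound on the means holds for every subadditive function;
    (PQ) enters only through the lower bound, when the infimum is real. *)
Lemma PQ_SET (R : realType) (A : finType) (Omega : set (full_shift A)) :
  Omega !=set0 -> PQ R Omega -> SET R Omega.
Proof.
move=> Omega0 pq F Fsub; set m := ereal_inf _.
have up b : (m < b%:E)%E -> exists2 K, 0 <= K &
    forall w, language Omega w -> F w <= b * (size w)%:R + K.
  move=> /ereal_inf_lt[_ [n n0 <-] mb].
  apply: (subadditive_affine_bound Fsub n0) => v Lv vn.
  by rewrite -ler_pdivrMr ?ltr0n//; apply/ltW; exact: max_mean_lt mb Lv vn.
have near_up b b' : (m < b%:E)%E -> b < b' ->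
    \forall w \near long_words Omega, F w / (size w)%:R <= b'.
  by move=> /up[K _ HK] bb'; apply: (@near_mean_le _ _ _ _ b _ K 0) => // w Lw _; exact: HK.
case mE : m => [r||].
- have up' e : 0 < e -> (m < (r + e)%:E)%E by rewrite mE lte_fin ltrDl.
  apply: cvg_EFin; first exact: nearW.
  apply/cvgrPdist_le => d d0.
  have d2 : 0 < d / 2 by rewrite divr_gt0.
  have Hup : \forall w \near long_words Omega, F w / (size w)%:R <= r + d.
    by apply: near_up (up' _ d2) _; lra.
  have Hlow : \forall w \near long_words Omega, r - d <= F w / (size w)%:R.
    by apply: near_mean_lower => // e /up'/up.
  apply: filterS2 Hup Hlow => w /= wu wl.
  by rewrite ler_norml; apply/andP; split; lra.
- suff : (m < +oo)%E by rewrite mE.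
  apply: le_lt_trans (_ : (max_mean Omega F 1 < +oo)%E).
    by apply: ereal_inf_lbound; exists 1%N.
  by apply: bigmax_lt => // v _; rewrite ltry.
- apply/cvgeNyPle => b.
  have := near_up (b - 1) b; rewrite mE ltNyr => /(_ isT).
  rewrite ltrBlDr ltrDl ltr01 => /(_ isT).
  by apply: filterS => w; rewrite lee_fin.
Qed.

(** * From the subadditive ergodic theorem to quasiweights *)

Lemma cvge_near_lt (R : realType) (T : Type) (G : set_system T)
    (f : T -> \bar R) (x a : \bar R) :
  f @ G --> x -> (x < a)%E -> \forall t \near G, (f t < a)%E.
Proof.
move=> fx xa; apply: (fx [set y | (y < a)%E]); apply: open_nbhs_nbhs.
by split => //; exact: open_ereal_lt_ereal.
Qed.

Lemma cvge_near_gt (R : realType) (T : Type) (G : set_system T)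
    (f : T -> \bar R) (x a : \bar R) :
  f @ G --> x -> (a < x)%E -> \forall t \near G, (a < f t)%E.
Proof.
move=> fx xa; apply: (fx [set y | (a < y)%E]); apply: open_nbhs_nbhs.
by split => //; exact: open_ereal_gt_ereal.
Qed.

(** The lower limit defining the quasiweight is a limit under (SET), because
    [- covered_length v] is subadditive; so its smallness bounds all long
    words and not just some of them. *)
Lemma SET_covered_length (R : realType) (A : finType)
    (Omega : set (full_shift A)) (v : seq A) (C : R) :
  SET R Omega -> 0 < C -> (quasiweight R Omega v < C%:E)%E ->
  exists N, forall w, language Omega w -> (N <= size w)%N ->
    (covered_length v w)%:R <= 2 * C * (size w)%:R.
Proof.
move=> set_ C0 vC; set F := fun w => - (covered_length v w)%:R : R.
have Fsub : Defs.subadditive Omega F.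
  move=> u w _; rewrite /F -opprD lerN2 -natrD ler_nat.
  exact: covered_length_superadditive.
have := set_ F Fsub; set x := ereal_inf _ => Fx.
case: (ltP x (- C)%:E) => xC.
  have [N _ HN] := cvge_near_lt Fx xC.
  exfalso; move: vC; rewrite ltNge => /negP; apply.
  rewrite /quasiweight limf_einfE; apply: le_trans (ereal_sup_ubound _); last first.
    by exists [set w | language Omega w /\ (N <= size w)%N] => //; exists N.
  apply: le_ereal_inf_tmp => _ [w [Lw Nw] <-].
  have := HN w (conj Lw Nw); rewrite /= lte_fin lee_fin /F mulNr ltrN2.
  exact: ltW.
have xC2 : ((- (2 * C))%:E < x)%E.
  by apply: lt_le_trans xC; rewrite lte_fin; lra.
have [N _ HN] := cvge_near_gt Fx xC2.
exists N.+1 => w Lw Nw; have := HN w (conj Lw (ltnW Nw)).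
rewrite /= lte_fin /F mulNr ltrN2 ltr_pdivrMr ?ltr0n; last lia.
exact: ltW.
Qed.

(** A word [v] violating (PQ) for the constant [e / (2 (M + 1))] may be short.
    Prolonging it by [M] letters makes it long and multiplies its coverage by
    at most [(|v| + M) / |v| <= M + 1]. *)
Lemma SET_rare_words (R : realType) (A : finType) (Omega : set (full_shift A))
    (e : R) (M : nat) :
  SET R Omega -> ~ PQ R Omega -> 0 < e ->
  exists2 v, language Omega v /\ (M < size v)%N &
    exists N, forall w, language Omega w -> (N <= size w)%N ->
      (covered_length v w)%:R <= e * (size w)%:R.
Proof.
move=> set_ npq e0; pose C : R := e / M.+1%:R / 2.
have C0 : 0 < C by rewrite /C !divr_gt0.
have [v [Lv v0 vC]] : exists v, [/\ language Omega v, v != [::] &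
    (quasiweight R Omega v < C%:E)%E].
  apply: contrapT => nv; apply: npq; exists C => // v Lv v0.
  by rewrite leNgt; apply/negP => vC; apply: nv; exists v.
have [N HN] := SET_covered_length set_ C0 vC.
have [v' Lvv' v'M] := language_extend M Lv.
have {}v0 : (0 < size v)%N by rewrite lt0n size_eq0.
exists (v ++ v'); first by split => //; rewrite size_cat; lia.
exists N => w Lw Nw; have := HN w Lw Nw.
have -> : 2 * C = e / M.+1%:R by rewrite /C mulrC divfK.
rewrite mulrAC ler_pdivlMr ?ltr0n// -natrM => le_e.
apply: le_trans le_e; rewrite ler_nat.
rewrite -(leq_pmul2r v0); apply: (leq_trans (covered_length_extend _ _ _)).
by rewrite size_cat v'M -mulnA leq_mul2l mulSn leq_add2l leq_pmulr ?orbT.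
Qed.

(** The threshold [N k] after which [v k] is rare is fixed before [v k.+1] is
    chosen, so that [v k.+1] and its successors are too long to occur in words
    of length [N k]. *)
Lemma rare_words_sequence (R : realType) (A : finType)
    (Omega : set (full_shift A)) (e : nat -> R) :
  (forall (k M : nat), exists2 v, language Omega v /\ (M < size v)%N &
    exists N, forall w, language Omega w -> (N <= size w)%N ->
      (covered_length v w)%:R <= e k * (size w)%:R) ->
  exists (v : nat -> seq A) (N : nat -> nat),
    [/\ forall k, language Omega (v k),
        forall k, (k < size (v k) <= N k)%N,
        forall k n, (k < n)%N -> (N k < size (v n))%N &
        forall k w, language Omega w -> (N k <= size w)%N ->
          (covered_length (v k) w)%:R <= e k * (size w)%:R].
Proof.
move=> rare.
have step (p : nat * nat) : exists q : seq A * nat,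
    [/\ language Omega q.1, (p.2 < size q.1 <= q.2)%N &
      forall w, language Omega w -> (q.2 <= size w)%N ->
        (covered_length q.1 w)%:R <= e p.1 * (size w)%:R].
  have [v [Lv Mv] [N HN]] := rare p.1 p.2.
  exists (v, maxn N (size v)); split => //=; first by rewrite Mv leq_maxr.
  by move=> w Lw; rewrite geq_max => /andP[Nw _]; exact: HN.
have [g Hg] := choice step.
pose st := fix st k := if k is k'.+1 then g (k, (st k').2) else g (0%N, 0%N).
have stE k : exists M, st k = g (k, M).
  by case: k => [|k]; [exists 0%N|exists (st k).2].
have HL k : language Omega (st k).1.
  by have [M ->] := stE k; case: (Hg (k, M)).
have Hs k : (size (st k).1 <= (st k).2)%N.
  by have [M ->] := stE k; case: (Hg (k, M)) => _ /andP[].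
have HS k : ((st k).2 < size (st k.+1).1)%N.
  by case: (Hg (k.+1, (st k).2)) => _ /andP[].
have He k w : language Omega w -> ((st k).2 <= size w)%N ->
    (covered_length (st k).1 w)%:R <= e k * (size w)%:R.
  by have [M ->] := stE k; case: (Hg (k, M)) => _ _ /(_ w).
exists (fun k => (st k).1), (fun k => (st k).2); split => // [k|k n].
  rewrite Hs andbT; elim: k => [|k IH]; first by case: (Hg (0, 0)%N) => _ /andP[].
  exact: leq_ltn_trans (leq_trans IH (Hs k)) (HS k).
elim: n => // n IH; rewrite ltnS leq_eqVlt => /predU1P[-> //|/IH kn].
exact: leq_trans kn (leq_trans (Hs n) (ltnW (HS n))).
Qed.

(** The cut-off at [size w] makes the sum finite for every sequence; it keeps
    superadditivity, since a longer word only gets more nonnegative summands.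
    When [v k] is longer than [k], it only discards zeros. *)
Definition total_covered (A : finType) (v : nat -> seq A) (w : seq A) : nat :=
  (\sum_(k < size w) covered_length (v k) w)%N.

Lemma total_covered_superadditive (A : finType) (v : nat -> seq A)
    (u w : seq A) :
  (total_covered v u + total_covered v w <= total_covered v (u ++ w))%N.
Proof.
have widen (f : nat -> nat) a b : (a <= b)%N ->
    (\sum_(k < a) f k <= \sum_(k < b) f k)%N.
  by move=> /subnKC <-; rewrite big_split_ord /= leq_addr.
have split_le : (\sum_(k < size (u ++ w))
    (covered_length (v k) u + covered_length (v k) w) <=
    total_covered v (u ++ w))%N.
  by apply: leq_sum => k _; exact: covered_length_superadditive.
apply: leq_trans split_le; rewrite big_split /=; apply: leq_add.
  by apply: (widen (fun k => covered_length (v k) u)); rewrite size_cat leq_addr.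
by apply: (widen (fun k => covered_length (v k) w)); rewrite size_cat leq_addl.
Qed.

Lemma sum_halves (R : realType) (n : nat) :
  \sum_(k < n) (2^-1 : R) ^+ k.+2 <= 2^-1.
Proof.
suff -> : \sum_(k < n) (2^-1 : R) ^+ k.+2 = 2^-1 - 2^-1 ^+ n.+1.
  by rewrite gerBl exprn_ge0// invr_ge0.
elim: n => [|n IH]; first by rewrite big_ord0 expr1 subrr.
by rewrite big_ord_recr /= IH !exprS; lra.
Qed.

(** Failure of (PQ) yields a subadditive function whose means are at most
    [- 1] on one sequence of words of growing length and at least [- 1/2] on
    another. *)
Lemma SET_PQ (R : realType) (A : finType) (Omega : set (full_shift A)) :
  Omega !=set0 -> SET R Omega -> PQ R Omega.
Proof.
move=> Omega0 set_; apply: contrapT => npq.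
pose e (k : nat) : R := 2^-1 ^+ k.+2.
have e0 k : 0 < e k by rewrite exprn_gt0// invr_gt0.
have [v [N [Lv vN Nv rare]]] := rare_words_sequence
  (fun k M => SET_rare_words M set_ npq (e0 k)).
pose F w : R := - (total_covered v w)%:R.
have Fsub : Defs.subadditive Omega F.
  move=> u w _; rewrite /F -opprD lerN2 -natrD ler_nat.
  exact: total_covered_superadditive.
have Fv k : F (v k) / (size (v k))%:R <= - 1.
  have [/andP[kv _]] := vN k.
  rewrite /F mulNr lerN2 ler_pdivlMr ?mul1r ?ltr0n ?ler_nat; last lia.
  rewrite /total_covered (bigD1 (Ordinal kv))//=.
  exact: leq_trans (covered_length_self _) (leq_addr _ _).
have Fw n w : language Omega w -> size w = N n ->
    - 2^-1 <= F w / (size w)%:R.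
  move=> Lw wN; have := vN n => /andP[nv vn].
  have nw : (n < size w)%N by rewrite wN; exact: leq_trans nv vn.
  have w0 : 0 < (size w)%:R :> R by rewrite ltr0n; lia.
  rewrite /F mulNr lerN2 ler_pdivrMr//.
  (* Up to index [n] the word is long enough for rarity to apply; beyond [n]
     the words do not fit. *)
  have <- : (\sum_(k < n.+1 + (size w - n.+1)) covered_length (v k) w)%N =
    total_covered v w by rewrite subnKC.
  rewrite big_split_ord /= [X in (_ + X)%N]big1 ?addn0; last first.
    move=> k _; apply: covered_length_small.
    apply: leq_ltn_trans (_ : N n < _)%N; first by rewrite wN.
    by apply: Nv; rewrite addSn ltnS leq_addr.
  rewrite natr_sum.
  apply: le_trans (_ : (\sum_(k < n.+1) e k) * (size w)%:R <= _).
    rewrite mulr_suml; apply: ler_sum => k _; apply: rare => //; rewrite wN.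
    have := ltn_ord k; rewrite ltnS leq_eqVlt => /predU1P[-> //|/Nv kn].
    exact: leq_trans (ltnW kn) vn.
  by rewrite ler_wpM2r// sum_halves.
have := set_ F Fsub; set x := ereal_inf _ => Fx.
case: (ltP x (- 2^-1 : R)%:E) => xC.
  have [M _ HM] := cvge_near_lt Fx xC.
  have [w Lw wN] := language_word (N M) Omega0.
  have Mw : (M <= size w)%N by rewrite wN; have /andP[] := vN M; lia.
  have := HM w (conj Lw Mw); rewrite /= lte_fin ltNge.
  by rewrite (Fw M).
have xC1 : ((- 1)%:E < x)%E by apply: lt_le_trans xC; rewrite lte_fin; lra.
have [M _ HM] := cvge_near_gt Fx xC1.
have Mv : (M <= size (v M))%N by have /andP[] := vN M; lia.
by have := HM (v M) (conj (Lv M) Mv); rewrite /= lte_fin ltNge Fv.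
Qed.

Theorem theorem2 (R : realType) (A : finType) (Omega : set (full_shift A)) :
  minimal_subshift Omega -> (SET R Omega <-> PQ R Omega).
Proof. by move=> [[neO _ _] _]; split; [exact: SET_PQ|exact: PQ_SET]. Qed.
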